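(* Let $r>0$ and $N\ge r+2$ be integers and let $A=\{A_{ij}\}_{i,j=1}^N$ be a complex strongly regular two-sided band matrix of order $r$, i.e. $A_{ij}=0$ for $|i-j|>r$. The matrix $A$ admits the factorization $A=LR$, where $L$ is a lower triangular matrix whose inverse is represented as the product $$L^{-1}=\tilde L_{N-r+1}\tilde L_{N-r}\cdots\tilde L_1,\qquad \tilde L_k=I_{k-1}\oplus L_k\oplus I_{N-k-r}\ (k=1,\dots,N-r),\qquad\tilde L_{N-r+1}=I_{N-r}\oplus L_{N-r+1},$$ with lower triangular matrices $L_k$ (of size $(r+1)\times(r+1)$ for $k\le N-r$ and $r\times r$ for $k=N-r+1$), and $R$ is an upper triangular, upper band matrix of order $r$. Moreover the matrices $L_k$ and the nonzero upper triangular entries of $R$ are obtained as follows. 1.1. Set $\gamma_1=A(1,1)$, $f_1=A(2:r+1,1)/\gamma_1$, $X_1=A(1,2:r+1)$, $$Y_1=-f_1\begin{pmatrix}X_1&0\end{pmatrix}+A(2:r+1,2:r+2),\qquad L_1=\begin{pmatrix}1&0\\ -f_1&I_r\end{pmatrix},$$ $R(1,1)=\gamma_1$, $R(1,2:r+1)=A(1,2:r+1)$. 1.2. For $k=2,\dots,N-r-1$ set $\gamma_k=Y_{k-1}(1,1)$, $X_k=Y_{k-1}(1,2:r+1)$, $$f_k=\begin{pmatrix}Y_{k-1}(2:r,1)\\ A(k+r,k)\end{pmatrix}\frac1{\gamma_k},\qquad Z_k=\begin{pmatrix}\begin{matrix}Y_{k-1}(2:r,2:r+1)&A(k+1:k+r-1,k+r+1)\end{matrix}\\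 A(k+r,k+1:k+r+1)\end{pmatrix},$$ $$Y_k=-f_k\begin{pmatrix}X_k&0\end{pmatrix}+Z_k,\qquad L_k=\begin{pmatrix}1&0\\ -f_k&I_r\end{pmatrix},$$ $R(k,k)=\gamma_k$, $R(k,k+1:k+r)=X_k$. 1.3. Set $\gamma_{N-r}=Y_{N-r-1}(1,1)$, $X_{N-r}=Y_{N-r-1}(1,2:r+1)$, $$f_{N-r}=\begin{pmatrix}Y_{N-r-1}(2:r,1)\\ A(N,N-r)\end{pmatrix}\frac1{\gamma_{N-r}},\qquad Z_{N-r}=\begin{pmatrix}Y_{N-r-1}(2:r,2:r+1)\\ A(N,N-r+1:N)\end{pmatrix},$$ $$Y_{N-r}=-f_{N-r}X_{N-r}+Z_{N-r},\qquad L_{N-r}=\begin{pmatrix}1&0\\ -f_{N-r}&I_r\end{pmatrix},$$ $R(N-r,N-r)=\gamma_{N-r}$, $R(N-r,N-r+1:N)=X_{N-r}$. Compute the LU factorization $Y_{N-r}=T_{N-r+1}S_{N-r+1}$ with $T_{N-r+1}$ unit lower triangular and $S_{N-r+1}$ upper triangular, and set $L_{N-r+1}=T_{N-r+1}^{-1}$, $R(N-r+1:N,N-r+1:N)=S_{N-r+1}$. Next, lower Green generators $p(i),q(i),a(i)$ $(i=1,\dots,N-r)$, $p(N-r+1)$ of the matrix $A^{-1}=R^{-1}L^{-1}$ are obtained as follows, where $p_L(i),d_L(i),a_L(i),q_L(i)$ (of sizes $1\times r$, $1\times1$, $r\times r$, $r\times1$) are defined by the partitions $L_i=\begin{pmatrix}p_L(i)&d_L(i)\\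 a_L(i)&q_L(i)\end{pmatrix}$, $i=1,\dots,N-r$, and $x_k=R(k,k)=\gamma_k$. 2.1. Set $q(k)=q_L(k)$, $a(k)=a_L(k)$, $k=1,\dots,N-r$. 2.2. Set $p(N-r+1)=S_{N-r+1}^{-1}L_{N-r+1}$, $t_{N-r+1}=p(N-r+1)$, and for $k=N-r,\dots,1$ compute $$p(k)=\frac1{x_k}\bigl(p_L(k)-X_kt_{k+1}a(k)\bigr),\qquad t_k=\begin{pmatrix}p(k)\\ t_{k+1}(1:r-1,:)\,a(k)\end{pmatrix}.$$
   Context: Notation: $M(i:j,k:l)$ denotes the submatrix of $M$ with rows $i,\dots,j$ and columns $k,\dots,l$ (a single index denotes one row or column, '':'' alone means all indices; empty ranges give empty blocks). $I_k$ is the identity of order $k$ ($I_0$ empty), $\oplus$ is the block diagonal direct sum. A matrix $R$ is upper band of order $r$ if $R_{ij}=0$ for $j-i>r$. $A$ is strongly regular if all its leading principal minors are nonzero. Lower Green generators. Let $p(i)$ ($1\times r$), $q(i)$ ($r\times1$), $a(i)$ ($r\times r$), $i=1,\dots,N-r$, and an $r\times r$ matrix $p(N-r+1)$ be given. They are lower Green generators (of order $r$) of an $N\times N$ matrix $B$ if, with empty products of $a$'s equal to $I_r$: $B(i,1:r)=p(i)a(i-1)\cdots a(1)$ for $1\le i\le N-r$; $B(i,r+j)=p(i)a(i-1)\cdots a(j+1)q(j)$ for $1\le j<i\le N-r$; $B(N-r+1:N,1:r)=p(N-r+1)a(N-r)\cdots a(1)$; $B(N-r+1:N,r+j)=p(N-r+1)a(N-r)\cdots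 a(j+1)q(j)$ for $1\le j\le N-r$. *)

(* Defs.v *)
From mathcomp Require Import all_boot all_order all_algebra.
From mathcomp Require Export complex.
From mathcomp Require Export reals.

Set Implicit Arguments.
Unset Strict Implicit.
Unset Printing Implicit Defensive.

Import GRing.Theory.
Local Open Scope ring_scope.

(* All row, column and step indices are natural numbers starting from 1. *)

Section Submatrices.
Variable F : fieldType.

(* M(i,j); the value 0 outside the range of M is never used. *)
Definition ent m n (M : 'M[F]_(m, n)) (i j : nat) : F :=
  match insub i.-1, insub j.-1 with
  | Some u, Some v => M u v
  | _, _ => 0
  end.

(* subm M i k m' n' = M(i:i+m'-1, k:k+n'-1).  With i = k = 1 and m' = m,
   n' = n propositionally, it serves as a cast between equal sizes, as in
   subm M 1 1 r n for M with r.-1 + 1 rows. *)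
Definition subm m n (M : 'M[F]_(m, n)) (i k m' n' : nat) : 'M[F]_(m', n') :=
  \matrix_(u < m', v < n') ent M (i + u) (k + v).

Definition dsum m n (A : 'M[F]_m) (B : 'M[F]_n) : 'M[F]_(m + n) :=
  block_mx A 0 0 B.

Definition upper_triangular n (M : 'M[F]_n) : bool := is_trig_mx M^T.

Definition unit_lower_triangular n (M : 'M[F]_n) : Prop :=
  is_trig_mx M /\ forall i, M i i = 1.

Definition upper_band n (r : nat) (M : 'M[F]_n) : Prop :=
  forall i j : 'I_n, (i + r < j)%N -> M i j = 0.

Definition two_sided_band n (r : nat) (M : 'M[F]_n) : Prop :=
  forall i j : 'I_n, (i + r < j)%N || (j + r < i)%N -> M i j = 0.

Definition strongly_regular n (M : 'M[F]_n) : Prop :=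
  forall k, (1 <= k <= n)%N -> \det (subm M 1 1 k k) != 0.

Definition LU_factorization n (M T S : 'M[F]_n) : Prop :=
  [/\ unit_lower_triangular T, upper_triangular S & M = T *m S].

(* The product a(i) a(i-1) ... a(j), equal to the identity when i < j. *)
Definition descprod n (a : nat -> 'M[F]_n) (i j : nat) : 'M[F]_n :=
  \big[mulmx/1%:M]_(k <- rev (index_iota j i.+1)) a k.

(* pN is the r x r generator p(N-r+1). *)
Definition lower_Green_generators N r (B : 'M[F]_N)
    (p : nat -> 'M[F]_(1, r)) (q : nat -> 'M[F]_(r, 1))
    (a : nat -> 'M[F]_r) (pN : 'M[F]_r) : Prop :=
  [/\ forall i, (1 <= i <= N - r)%N ->
        subm B i 1 1 r = p i *m descprod a i.-1 1,
      forall i j, (1 <= j)%N -> (j < i)%N -> (i <= N - r)%N ->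
        subm B i (r + j) 1 1 = p i *m descprod a i.-1 j.+1 *m q j,
      subm B (N - r).+1 1 r r = pN *m descprod a (N - r) 1
    & forall j, (1 <= j <= N - r)%N ->
        subm B (N - r).+1 (r + j) r 1
          = pN *m descprod a (N - r) j.+1 *m q j].

End Submatrices.

Section Algorithm.
Variables (F : fieldType) (N : nat) (A : 'M[F]_N) (r : nat).

(* The quantities of step k, with Y standing for Y_{k-1} (unused if k = 1). *)

Definition step_gamma (k : nat) (Y : 'M[F]_(r, r + 1)) : F :=
  if k == 1%N then ent A 1 1 else ent Y 1 1.

Definition step_X (k : nat) (Y : 'M[F]_(r, r + 1)) : 'M[F]_(1, r) :=
  if k == 1%N then subm A 1 2 1 r else subm Y 1 2 1 r.

Definition step_f (k : nat) (Y : 'M[F]_(r, r + 1)) : 'M[F]_(r, 1) :=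
  (step_gamma k Y)^-1 *:
    (if k == 1%N then subm A 2 1 r 1
     else subm (col_mx (subm Y 2 1 r.-1 1) (subm A (k + r) k 1 1)) 1 1 r 1).

Definition step_Z (k : nat) (Y : 'M[F]_(r, r + 1)) : 'M[F]_(r, r + 1) :=
  if k == 1%N then subm A 2 2 r (r + 1)
  else subm (col_mx (row_mx (subm Y 2 2 r.-1 r)
                            (subm A k.+1 (k + r).+1 r.-1 1))
                    (subm A (k + r) k.+1 1 (r + 1)))
            1 1 r (r + 1).

(* schur k is Y_k for 1 <= k <= N-r-1; the value at 0 is a dummy. *)
Fixpoint schur (k : nat) : 'M[F]_(r, r + 1) :=
  if k is k'.+1 then
    - step_f k (schur k') *m row_mx (step_X k (schur k')) 0
      + step_Z k (schur k')
  else 0.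

Definition gamma (k : nat) : F := step_gamma k (schur k.-1).
Definition Xrow (k : nat) : 'M[F]_(1, r) := step_X k (schur k.-1).
Definition fcol (k : nat) : 'M[F]_(r, 1) := step_f k (schur k.-1).

(* Z_{N-r} and Y_{N-r}, which have one column less than the previous ones. *)
Definition Zlast : 'M[F]_r :=
  subm (col_mx (subm (schur (N - r).-1) 2 2 r.-1 r)
               (subm A N (N - r).+1 1 r)) 1 1 r r.

Definition Ylast : 'M[F]_r := - fcol (N - r) *m Xrow (N - r) + Zlast.

(* L_k for 1 <= k <= N-r *)
Definition Lfac (k : nat) : 'M[F]_(1 + r) :=
  block_mx 1%:M 0 (- fcol k) 1%:M.

Definition Ltilde (k : nat) : 'M[F]_N :=
  subm (dsum (dsum (1%:M : 'M_k.-1) (Lfac k)) (1%:M : 'M_(N - k - r))) 1 1 N N.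

(* Below, T and S are the factors of an LU factorization of Y_{N-r}. *)

(* L_{N-r+1} *)
Definition Lfac_last (T : 'M[F]_r) : 'M[F]_r := invmx T.

Definition Ltilde_last (T : 'M[F]_r) : 'M[F]_N :=
  subm (dsum (1%:M : 'M_(N - r)) (Lfac_last T)) 1 1 N N.

Definition Linv_product (T : 'M[F]_r) : 'M[F]_N :=
  Ltilde_last T *m descprod Ltilde (N - r) 1.

(* L_k = [p_L(k) d_L(k); a_L(k) q_L(k)] with a_L(k) of size r x r *)
Definition pL (k : nat) : 'M[F]_(1, r) := subm (Lfac k) 1 1 1 r.
Definition aL (k : nat) : 'M[F]_r := subm (Lfac k) 2 1 r r.
Definition qL (k : nat) : 'M[F]_(r, 1) := subm (Lfac k) 2 r.+1 r 1.

Definition green_q (k : nat) : 'M[F]_(r, 1) := qL k.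
Definition green_a (k : nat) : 'M[F]_r := aL k.
Definition green_p_last (T S : 'M[F]_r) : 'M[F]_r := invmx S *m Lfac_last T.

(* p(k) computed from t = t_{k+1} *)
Definition step_p (k : nat) (t : 'M[F]_r) : 'M[F]_(1, r) :=
  (gamma k)^-1 *: (pL k - Xrow k *m t *m green_a k).

(* green_t_down T S d is t_{N-r+1-d}. *)
Fixpoint green_t_down (T S : 'M[F]_r) (d : nat) : 'M[F]_r :=
  if d is d'.+1 then
    let k := (N - r - d')%N in
    let t := green_t_down T S d' in
    subm (col_mx (step_p k t) (subm t 1 1 r.-1 r *m green_a k)) 1 1 r r
  else green_p_last T S.

Definition green_t (T S : 'M[F]_r) (k : nat) : 'M[F]_r :=
  green_t_down T S ((N - r).+1 - k).

Definition green_p (T S : 'M[F]_r) (k : nat) : 'M[F]_(1, r) :=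
  step_p k (green_t T S k.+1).

End Algorithm.

(* Main.v *)
Require Import Defs.
From mathcomp Require Import all_boot all_order all_algebra.
From mathcomp Require Import zify.

(** A strongly regular matrix has a factorization [A = L *m U] with [L] unit
    lower triangular and [U] upper triangular ([strongly_regular_LU]), and
    forward substitution shows that both factors inherit the band width [r] of
    [A].  Everything computed by the algorithm can then be read off from [L],
    [U] and [B = invmx A].

    Elimination.  After [k] steps the active window [schur A r k] is a window
    of the Schur complement [A - L(:,1:k) U(1:k,:)] ([schurP]).  Indeed step
    [k] subtracts the rank one term [L(:,k) U(k,:)], and the row and the column
    that enter the window are still those of [A] because the previous columns
    of [L] and rows of [U] do not reach them.  Hence [gamma k], [Xrow k] and
    [fcol k] are the diagonal entry and the row of [U] and the column of [L]
    at [k], and [Ylast] is the product of the trailing blocks of [L] and [U];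
    uniqueness of such factorizations identifies these blocks with [S] and [T].
    Since [Ltilde k] clears column [k] of [L], the product of all the [Ltilde]
    is the inverse of [L] ([invL]).

    Green generators.  From [B = U^-1 L^-1] one gets two triangular matrices,
    [B *m L = U^-1] and [U *m B = L^-1].  By the first one, in the rows below
    [k], column [k] of [B] is minus the combination of the next [r] columns with
    coefficients [fcol k]; in matrix form,
    [B(i, k+1:k+r) *m L_k(2:r+1, :) = B(i, k:k+r)] for [i > k]
    ([inv_window]).  Its columns say that [a(k)] shifts a window of [B] by one
    column to the left ([green_shift_a]) and that [q(k)] extracts its last
    column ([green_shift_q]).  Row [k] of the second one,
    [gamma_k B(k, k:k+r-1) + X_k B(k+1:k+r, k:k+r-1) = (1 0 ... 0)],
    is the recursion for [p(k)].  So [t_k] is the diagonal block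
    [B(k:k+r-1, k:k+r-1)] and [p(k)] its first row ([green_t_down_inv]), and
    shifting windows repeatedly gives all the Green formulas. *)

Set Implicit Arguments.
Unset Strict Implicit.
Unset Printing Implicit Defensive.

Import GRing.Theory.
Local Open Scope ring_scope.

(** * Entries and submatrices in one-based indexing *)

Lemma entE (F : fieldType) m n (M : 'M[F]_(m, n)) (u : 'I_m) (v : 'I_n) :
  ent M u.+1 v.+1 = M u v.
Proof. by rewrite /ent /= !valK. Qed.

Lemma ent_out (F : fieldType) m n (M : 'M[F]_(m, n)) i j :
  (m < i)%N || (n < j)%N -> ent M i j = 0.
Proof.
rewrite /ent; case/orP => lt_dim.
  by rewrite insubF //; apply/negbTE; lia.
by case: insub => // u; rewrite insubF //; apply/negbTE; lia.
Qed.

(** Entries out of range are 0, which leaves the in-range ones to check. *)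
Lemma ent_case (F : fieldType) m n (M : 'M[F]_(m, n)) i j (P : F -> Prop) :
  (0 < i)%N -> (0 < j)%N -> P 0 ->
  (forall (u : 'I_m) (v : 'I_n), i = u.+1 -> j = v.+1 -> P (M u v)) ->
  P (ent M i j).
Proof.
move=> i_gt0 j_gt0 P0 PM.
have [le_im|lt_mi] := leqP i m; last by rewrite ent_out // lt_mi.
have [le_jn|lt_nj] := leqP j n; last by rewrite ent_out // lt_nj orbT.
have lt_im : (i.-1 < m)%N by lia.
have lt_jn : (j.-1 < n)%N by lia.
have Ei : i = (Ordinal lt_im).+1 by rewrite /= prednK.
have Ej : j = (Ordinal lt_jn).+1 by rewrite /= prednK.
by rewrite {1}Ei {1}Ej entE; apply: PM.
Qed.

Lemma ent_eqP (F : fieldType) m n (M P : 'M[F]_(m, n)) :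
  (forall i j, (1 <= i <= m)%N -> (1 <= j <= n)%N -> ent M i j = ent P i j) ->
  M = P.
Proof. by move=> eqMP; apply/matrixP => u v; rewrite -!entE eqMP ?ltn_ord. Qed.

Lemma ent_mul (F : fieldType) m n p (M : 'M[F]_(m, n)) (P : 'M[F]_(n, p)) i j :
  ent (M *m P) i j = \sum_(1 <= l < n.+1) ent M i l * ent P l j.
Proof.
rewrite big_add1 big_mkord /ent /=.
case: insub => [u|]; last by rewrite big1 // => l _; rewrite mul0r.
case: insub => [v|]; last by rewrite big1 // => l _; rewrite valK mulr0.
by rewrite mxE; apply: eq_bigr => l _; rewrite valK.
Qed.

Lemma ent_add (F : fieldType) m n (M P : 'M[F]_(m, n)) i j :
  ent (M + P) i j = ent M i j + ent P i j.
Proof.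
rewrite /ent; case: insub => [u|]; last by rewrite addr0.
by case: insub => [v|]; rewrite ?addr0 ?mxE.
Qed.

Lemma ent_scale (F : fieldType) m n (a : F) (M : 'M[F]_(m, n)) i j :
  ent (a *: M) i j = a * ent M i j.
Proof.
rewrite /ent; case: insub => [u|]; last by rewrite mulr0.
by case: insub => [v|]; rewrite ?mulr0 ?mxE.
Qed.

Lemma ent_opp (F : fieldType) m n (M : 'M[F]_(m, n)) i j :
  ent (- M) i j = - ent M i j.
Proof. by rewrite -scaleN1r ent_scale mulN1r. Qed.

Lemma ent0 (F : fieldType) m n i j : ent (0 : 'M[F]_(m, n)) i j = 0.
Proof. by rewrite -(scale0r (0 : 'M[F]_(m, n))) ent_scale mul0r. Qed.

Lemma ent_id (F : fieldType) n i j : (1 <= i <= n)%N -> (0 < j)%N ->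
  ent (1%:M : 'M[F]_n) i j = (i == j)%:R.
Proof.
case: i j => [//|i] [//|j] /= lt_in _.
have [lt_jn|le_nj] := ltnP j n; last first.
  by rewrite ent_out ?ltnS ?le_nj ?orbT //; case: eqP => // ?; lia.
by rewrite (entE _ (Ordinal lt_in) (Ordinal lt_jn)) mxE.
Qed.

Lemma ent_col_mx (F : fieldType) m p n (U : 'M[F]_(m, n)) (D : 'M[F]_(p, n))
    i j :
  (0 < i)%N -> (0 < j)%N ->
  ent (col_mx U D) i j = if (i <= m)%N then ent U i j else ent D (i - m) j.
Proof.
case: i j => [//|i] [//|j] _ _.
have [lt_jn|le_nj] := ltnP j n; last first.
  by rewrite !ent_out ?if_same //; lia.
case: ltnP => [lt_im|le_mi].
  have ltE := entE _ (lshift p (Ordinal lt_im)) (Ordinal lt_jn).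
  rewrite /= in ltE.
  by rewrite ltE (entE _ (Ordinal lt_im) (Ordinal lt_jn)) col_mxEu.
have [lt_i|le_i] := ltnP i (m + p); last by rewrite !ent_out //; lia.
have lt_ip : (i - m < p)%N by lia.
have ltE := entE _ (rshift m (Ordinal lt_ip)) (Ordinal lt_jn).
rewrite /= subnKC // in ltE; rewrite ltE subSn //.
by rewrite (entE _ (Ordinal lt_ip) (Ordinal lt_jn)) col_mxEd.
Qed.

Lemma ent_tr (F : fieldType) m n (M : 'M[F]_(m, n)) i j :
  ent M^T i j = ent M j i.
Proof.
rewrite /ent; case: insub => [u|]; case: insub => [v|] //.
by rewrite mxE.
Qed.

Lemma ent_row_mx (F : fieldType) m n p (P : 'M[F]_(m, n)) (Q : 'M[F]_(m, p))
    i j :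
  (0 < i)%N -> (0 < j)%N ->
  ent (row_mx P Q) i j = if (j <= n)%N then ent P i j else ent Q i (j - n).
Proof.
by move=> i_gt0 j_gt0; rewrite -ent_tr tr_row_mx ent_col_mx // !ent_tr.
Qed.

Lemma ent_subm (F : fieldType) m n (M : 'M[F]_(m, n)) i k m' n' x y :
  (1 <= x <= m')%N -> (1 <= y <= n')%N ->
  ent (subm M i k m' n') x y = ent M (i + x.-1) (k + y.-1).
Proof.
case/andP=> x_gt0 le_x /andP[y_gt0 le_y].
have lt_x : (x.-1 < m')%N by lia.
have lt_y : (y.-1 < n')%N by lia.
have Ex : x = (Ordinal lt_x).+1 by rewrite /= prednK.
have Ey : y = (Ordinal lt_y).+1 by rewrite /= prednK.
by rewrite {1}Ex {1}Ey entE mxE.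
Qed.

Lemma ent_dsum (F : fieldType) m n (M : 'M[F]_m) (P : 'M[F]_n) i j :
  (0 < i)%N -> (0 < j)%N ->
  ent (dsum M P) i j =
    if (i <= m)%N then if (j <= m)%N then ent M i j else 0
    else if (j <= m)%N then 0 else ent P (i - m) (j - m).
Proof.
move=> i_gt0 j_gt0; rewrite ent_col_mx //.
by case: leqP => lei; rewrite ent_row_mx ?ent0 ?subn_gt0.
Qed.

Lemma subm_full (F : fieldType) n (M : 'M[F]_n) : subm M 1 1 n n = M.
Proof. by apply/matrixP => u v; rewrite mxE !add1n entE. Qed.

Lemma subm_subm (F : fieldType) m n (M : 'M[F]_(m, n)) i k s t i' k' s' t' :
  (0 < i')%N -> (0 < k')%N -> (i' + s' <= s.+1)%N -> (k' + t' <= t.+1)%N ->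
  subm (subm M i k s t) i' k' s' t' = subm M (i + i'.-1) (k + k'.-1) s' t'.
Proof.
move=> i_gt0 k_gt0 le_s le_t; apply: ent_eqP => x y lex ley.
rewrite !ent_subm //; try lia.
by congr ent; lia.
Qed.

Lemma subm_col_mx (F : fieldType) m n (M : 'M[F]_(m, n)) i k s s' t :
  subm M i k (s + s') t = col_mx (subm M i k s t) (subm M (i + s) k s' t).
Proof.
apply: ent_eqP => x y lex ley; rewrite ent_subm // ent_col_mx; try lia.
case: leqP => le_xs; rewrite ent_subm //; try lia.
by congr ent; lia.
Qed.

Lemma subm_row_mx (F : fieldType) m n (M : 'M[F]_(m, n)) i k s t t' :
  subm M i k s (t + t') = row_mx (subm M i k s t) (subm M i (k + t) s t').
Proof.
apply: ent_eqP => x y lex ley; rewrite ent_subm // ent_row_mx; try lia.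
case: leqP => le_yt; rewrite ent_subm //; try lia.
by congr ent; lia.
Qed.

Lemma mul_subm_cols (F : fieldType) m n p (P : 'M[F]_(m, n)) (M : 'M[F]_(n, p))
    c t :
  P *m subm M 1 c n t = subm (P *m M) 1 c m t.
Proof.
apply/matrixP => u v; rewrite -!entE ent_subm ?ltn_ord // !ent_mul.
by apply: eq_big_nat => l lel; rewrite ent_subm ?ltn_ord.
Qed.

(** Block multiplication restricted to the inner indices that contribute:
    the factors may be cut to the window [c, c + w - 1] as soon as all the
    other terms of the sums vanish. *)
Lemma subm_mul_window (F : fieldType) m n p
    (M : 'M[F]_(m, n)) (P : 'M[F]_(n, p)) i j s t c w :
  (0 < c)%N -> (c + w <= n.+1)%N ->
  (forall x l y, (i <= x < i + s)%N -> (1 <= l <= n)%N -> (j <= y < j + t)%N ->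
     ~~ (c <= l < c + w)%N -> ent M x l * ent P l y = 0) ->
  subm (M *m P) i j s t = subm M i c s w *m subm P c j w t.
Proof.
move=> c_gt0 le_cw zero_out; apply: ent_eqP => x y lex ley.
rewrite ent_subm // !ent_mul (big_cat_nat (n := c)) //=; try lia.
rewrite [X in X + _]big_nat big1 ?add0r; last first.
  by move=> l lel; apply: zero_out; lia.
rewrite (big_cat_nat (n := c + w)%N) //=; try lia.
rewrite [X in _ + X]big_nat [X in _ + X]big1 ?addr0; last first.
  by move=> l lel; apply: zero_out; lia.
rewrite [RHS]big_add1 /= -{1}[c]add0n big_addn addKn !big_mkord.
apply: eq_bigr => l _; have ltl := ltn_ord l.
rewrite !ent_subm //; try lia.
by congr (ent M _ _ * ent P _ _); lia.
Qed.

(** * Triangular matrices and LU factorizations *)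

(** Forward substitution: a linear system with an invertible lower triangular
    matrix determines its first unknowns from its first equations alone. *)
Lemma trig_solve0 (F : fieldType) n p (T : 'M[F]_n) (X : 'M[F]_(n, p)) j c :
  is_trig_mx T -> (forall i, T i i != 0) ->
  (forall i : 'I_n, (i < c)%N -> (T *m X) i j = 0) ->
  forall i : 'I_n, (i < c)%N -> X i j = 0.
Proof.
move=> /is_trig_mxP trigT T_neq0 TX0 i.
have [m] := ubnP (i : nat); elim: m i => // m IHm i lt_im lt_ic.
have := TX0 i lt_ic; rewrite mxE (bigD1 i) //= big1 ?addr0 => [|l neq_li].
  by move/eqP; rewrite mulf_eq0 (negbTE (T_neq0 i)) => /eqP.
have [lt_il|le_li] := ltnP i l; first by rewrite trigT ?mul0r.
have lt_li : (l < i)%N by rewrite ltn_neqAle le_li andbT.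
by rewrite IHm ?mulr0 //; lia.
Qed.

Lemma trig_mulmx (F : fieldType) n (T P : 'M[F]_n) :
  is_trig_mx T -> is_trig_mx P -> is_trig_mx (T *m P).
Proof.
move=> /is_trig_mxP trigT /is_trig_mxP trigP; apply/is_trig_mxP => i j lt_ij.
rewrite mxE big1 // => l _; have [lt_il|le_li] := ltnP i l.
  by rewrite trigT ?mul0r.
by rewrite trigP ?mulr0 //; lia.
Qed.

Lemma trig_mulmx_diag (F : fieldType) n (T P : 'M[F]_n) i :
  is_trig_mx T -> is_trig_mx P -> (T *m P) i i = T i i * P i i.
Proof.
move=> /is_trig_mxP trigT /is_trig_mxP trigP.
rewrite mxE (bigD1 i) //= big1 ?addr0 // => l neq_li.
have [lt_il|le_li] := ltnP i l; first by rewrite trigT ?mul0r.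
by rewrite trigP ?mulr0 // ltn_neqAle le_li andbT.
Qed.

Lemma unitmx_trig (F : fieldType) n (T : 'M[F]_n) : is_trig_mx T ->
  (T \in unitmx) = [forall i, T i i != 0].
Proof.
move=> trigT; rewrite unitmxE det_trig // unitfE.
by apply/prodf_neq0/forallP => [T_neq0 i|T_neq0 i _]; apply: T_neq0.
Qed.

Lemma invmx_trig (F : fieldType) n (T : 'M[F]_n) :
  is_trig_mx T -> T \in unitmx -> is_trig_mx (invmx T).
Proof.
move=> trigT unitT; apply/is_trig_mxP => i j.
apply: (trig_solve0 trigT).
  by apply/forallP; rewrite -unitmx_trig.
move=> {}i lt_ij; rewrite mulmxV // mxE; case: eqP => // eq_ij.
by rewrite eq_ij ltnn in lt_ij.
Qed.

Lemma unit_lower_unitmx (F : fieldType) n (T : 'M[F]_n) :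
  unit_lower_triangular T -> T \in unitmx.
Proof.
case=> trigT T1; rewrite unitmx_trig //; apply/forallP => i.
by rewrite T1 oner_neq0.
Qed.

Lemma unit_lower_inv (F : fieldType) n (T : 'M[F]_n) :
  unit_lower_triangular T -> unit_lower_triangular (invmx T).
Proof.
move=> ulT; have unitT := unit_lower_unitmx ulT; case: ulT => trigT T1.
have trigTV := invmx_trig trigT unitT; split=> // i.
have := trig_mulmx_diag i trigT trigTV.
by rewrite mulmxV // mxE eqxx T1 mul1r.
Qed.

Lemma upper_inv (F : fieldType) n (S : 'M[F]_n) :
  upper_triangular S -> S \in unitmx -> upper_triangular (invmx S).
Proof.
by move=> uS unitS; rewrite /upper_triangular trmx_inv invmx_trig ?unitmx_tr.
Qed.

(** The matrix [T^-1 T' = S S'^-1] is both unit lower and upper triangular,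
    hence the identity. *)
Lemma LU_unique (F : fieldType) n (M T S T' S' : 'M[F]_n) :
  S' \in unitmx -> LU_factorization M T S -> LU_factorization M T' S' ->
  T = T' /\ S = S'.
Proof.
move=> unitS' [ulT uS defM] [ulT' uS' defM'].
have unitT := unit_lower_unitmx ulT.
pose D := invmx T *m T'.
have eqD : D = S *m invmx S'.
  apply: (can_inj (mulKmx unitT)); rewrite mulKVmx // mulmxA -defM defM'.
  by rewrite mulmxK.
have [[trigTV TV1] [trigT' T'1]] := (unit_lower_inv ulT, ulT').
have trigD : is_trig_mx D by apply: trig_mulmx.
have utrigD : is_trig_mx D^T.
  by rewrite eqD trmx_mul trig_mulmx //; apply: upper_inv.
have D1 : D = 1%:M.
  apply/matrixP => i j; rewrite [RHS]mxE; case: eqP => [<-|/eqP neq_ij].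
    by rewrite trig_mulmx_diag // TV1 T'1 mulr1.
  case: (ltngtP i j) => [lt_ij|lt_ji|/val_inj eq_ij].
  - exact: (is_trig_mxP trigD).
  - by have /is_trig_mxP/(_ j i lt_ji) := utrigD; rewrite mxE.
  by rewrite eq_ij eqxx in neq_ij.
split; first by rewrite -[T']mul1mx -(mulmxV unitT) -mulmxA -/D D1 mulmx1.
by rewrite -[S](mulmxKV unitS') -eqD D1 mul1mx.
Qed.

Lemma strongly_regular_unitmx (F : fieldType) n (M : 'M[F]_n) :
  strongly_regular M -> M \in unitmx.
Proof.
case: n M => [|n] M regM; first by rewrite unitmxE det_mx00 unitr1.
by rewrite unitmxE unitfE -[M]subm_full regM ?leqnn.
Qed.

(** Bordering: the factors of the leading block of order [n] are extended by
    one row and one column, for which this block has to be invertible. *)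
Lemma strongly_regular_LU (F : fieldType) n (M : 'M[F]_n) :
  strongly_regular M -> exists T S, LU_factorization M T S.
Proof.
elim: n M => [|n IHn] M.
  move=> _; exists 1%:M, 1%:M; split; last by apply/matrixP => -[].
    by split=> [|[]//]; apply/is_trig_mxP => -[].
  by apply/is_trig_mxP => -[].
move: M; rewrite -addn1 => M regM.
have ulM : ulsubmx M = subm M 1 1 n n.
  by apply/matrixP => u v; rewrite !mxE !add1n -entE.
have regM1 : strongly_regular (ulsubmx M).
  move=> k lek; rewrite ulM subm_subm //; try lia.
  by apply: regM; lia.
have [T [S [ulT uS defTS]]] := IHn _ regM1.
have := strongly_regular_unitmx regM1; rewrite defTS unitmx_mul.
case/andP=> unitT unitS.
pose b := dlsubmx M *m invmx S; pose c := invmx T *m ursubmx M.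
exists (block_mx T 0 b 1%:M), (block_mx S c 0 (drsubmx M - b *m c)); split.
- case: ulT => trigT T1; split.
    by rewrite is_trig_block_mx // eqxx trigT scalar_mx_is_trig.
  move=> i; case: (split_ordP i) => j ->; first by rewrite block_mxEul T1.
  by rewrite block_mxEdr mxE eqxx.
- rewrite /upper_triangular tr_block_mx is_trig_block_mx // trmx0 eqxx.
  by rewrite mx11_is_trig andbT; apply: uS.
rewrite mulmx_block !mulmx0 !mul0mx !addr0 !mul1mx subrKC mulKVmx //.
by rewrite mulmxKV // -defTS submxK.
Qed.

(** Column [j] of [S] solves a lower triangular system whose right-hand side,
    column [j] of [M], starts with zeros. *)
Lemma LU_upper_band (F : fieldType) n r (M T S : 'M[F]_n) :
  LU_factorization M T S -> two_sided_band r M -> upper_band r S.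
Proof.
case=> ulT _ -> bandM i j lt_irj; have unitT := unit_lower_unitmx ulT.
case: ulT => trigT _; have T_neq0 : forall k, T k k != 0.
  by apply/forallP; rewrite -unitmx_trig.
apply: (trig_solve0 (c := (j - r)%N) trigT T_neq0); last by lia.
by move=> k lt_kj; apply: bandM; lia.
Qed.

Lemma LU_lower_band (F : fieldType) n r (M T S : 'M[F]_n) :
  LU_factorization M T S -> S \in unitmx -> two_sided_band r M ->
  upper_band r T^T.
Proof.
case=> _ uS -> unitS bandM j i lt_jri.
have S_neq0 : forall k, S^T k k != 0.
  by apply/forallP; rewrite -unitmx_trig // unitmx_tr.
apply: (trig_solve0 (c := (i - r)%N) uS S_neq0); last by lia.
by move=> k lt_kj; rewrite -trmx_mul mxE; apply: bandM; lia.
Qed.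

Lemma ent_trig (F : fieldType) n (T : 'M[F]_n) i j :
  is_trig_mx T -> (0 < i)%N -> (i < j)%N -> ent T i j = 0.
Proof.
move=> /is_trig_mxP trigT i_gt0 lt_ij.
apply: (ent_case (P := fun x => x = 0)) => // [|u v Eu Ev]; first by lia.
by apply: trigT; lia.
Qed.

Lemma ent_unit_lower (F : fieldType) n (T : 'M[F]_n) i :
  unit_lower_triangular T -> (1 <= i <= n)%N -> ent T i i = 1.
Proof.
case=> _ T1; case: i => // i lt_i.
by rewrite (entE T (Ordinal lt_i) (Ordinal lt_i)).
Qed.

Lemma ent_band0 (F : fieldType) n r (M : 'M[F]_n) i j :
  upper_band r M -> (0 < i)%N -> (i + r < j)%N -> ent M i j = 0.
Proof.
move=> bandM i_gt0 lt_ij.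
apply: (ent_case (P := fun x => x = 0)) => // [|u v Eu Ev]; first by lia.
by apply: bandM; lia.
Qed.

(** * The elimination algorithm *)

Section Factors.
Variables (F : fieldType) (N r : nat) (A L U : 'M[F]_N).
Hypotheses (r_gt0 : (0 < r)%N) (leN : (r + 2 <= N)%N).
Hypotheses (bandA : two_sided_band r A) (LU_A : LU_factorization A L U).
Hypothesis (unitU : U \in unitmx).

Lemma ent_L_above i j : (0 < i)%N -> (i < j)%N -> ent L i j = 0.
Proof. by case: LU_A => -[trigL _] _ _; apply: ent_trig. Qed.

Lemma ent_L_diag i : (1 <= i <= N)%N -> ent L i i = 1.
Proof. by case: LU_A => ulL _ _; apply: ent_unit_lower. Qed.

Lemma ent_L_far i j : (0 < j)%N -> (j + r < i)%N -> ent L i j = 0.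
Proof.
by rewrite -ent_tr; apply: ent_band0 (LU_lower_band LU_A unitU bandA).
Qed.

Lemma ent_U_below i j : (0 < j)%N -> (j < i)%N -> ent U i j = 0.
Proof. by case: LU_A => _ uU _; rewrite -ent_tr; apply: ent_trig. Qed.

Lemma ent_U_far i j : (0 < i)%N -> (i + r < j)%N -> ent U i j = 0.
Proof. exact: ent_band0 (LU_upper_band LU_A bandA). Qed.

Lemma ent_U_diag i : (1 <= i <= N)%N -> ent U i i != 0.
Proof.
case: LU_A => _ uU _; case: i => // i lt_i.
rewrite (entE U (Ordinal lt_i) (Ordinal lt_i)).
have := unitU; rewrite -unitmx_tr unitmx_trig //.
by move/forallP/(_ (Ordinal lt_i)); rewrite mxE.
Qed.

(** The Schur complement of the leading block of order [k], at the absolute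
    position [(i, j)]: what is left of [A = L *m U] once the contribution of
    the first [k] columns of [L] is removed. *)
Definition schur_tail k i j : F :=
  \sum_(k.+1 <= l < N.+1) ent L i l * ent U l j.

Lemma schur_tail0 i j : schur_tail 0 i j = ent A i j.
Proof. by case: LU_A => _ _ ->; rewrite ent_mul. Qed.

Lemma schur_tailS k i j : (k < N)%N ->
  schur_tail k i j = ent L i k.+1 * ent U k.+1 j + schur_tail k.+1 i j.
Proof. by move=> lt_kN; rewrite /schur_tail big_ltn. Qed.

Lemma schur_tail_row k j : (k < N)%N -> schur_tail k k.+1 j = ent U k.+1 j.
Proof.
move=> lt_kN; rewrite schur_tailS // ent_L_diag // mul1r.
rewrite [schur_tail _ _ _]big_nat big1 ?addr0 // => l lel.
by rewrite ent_L_above ?mul0r //; lia.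
Qed.

Lemma schur_tail_col k i : (k < N)%N ->
  schur_tail k i k.+1 = ent L i k.+1 * ent U k.+1 k.+1.
Proof.
move=> lt_kN; rewrite schur_tailS //.
rewrite [schur_tail _ _ _]big_nat big1 ?addr0 // => l lel.
by rewrite ent_U_below ?mulr0 //; lia.
Qed.

(** Because the factors are banded, elimination of the first [k] columns
    has not yet reached the rows and columns beyond [k + r]. *)
Lemma schur_tail_far k i j : (k <= N)%N -> (k + r < i)%N || (k + r < j)%N ->
  schur_tail k i j = ent A i j.
Proof.
move=> le_kN far; rewrite -schur_tail0 /schur_tail.
rewrite [RHS](big_cat_nat (n := k.+1)) //=; try lia.
rewrite [X in _ = X + _]big_nat [X in _ = X + _]big1 ?add0r // => l lel.
case/orP: far => far; first by rewrite ent_L_far ?mul0r //; lia.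
by rewrite ent_U_far ?mulr0 //; lia.
Qed.

(** [Y] is the active window of the elimination after [k] steps; before the
    first step the window is read in [A] itself, hence the case [k = 0]. *)
Definition active_window k (Y : 'M[F]_(r, r + 1)) : Prop :=
  k = 0%N \/ forall u v, (1 <= u <= r)%N -> (1 <= v <= r + 1)%N ->
               ent Y u v = schur_tail k (k + u) (k + v).

Lemma step_gammaE k Y : (k < N - r)%N -> active_window k Y ->
  step_gamma A k.+1 Y = ent U k.+1 k.+1.
Proof.
move=> lt_k actY; rewrite -schur_tail_row; last by lia.
rewrite /step_gamma; case: actY => [-> /=|actY]; first by rewrite schur_tail0.
case: eqP => [[->]|neq_k1]; first by rewrite schur_tail0.
by rewrite actY ?addn1 //; lia.
Qed.

Lemma step_XE k Y : (k < N - r)%N -> active_window k Y ->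
  step_X A k.+1 Y = subm U k.+1 k.+2 1 r.
Proof.
move=> lt_k actY; apply: ent_eqP => x y lex ley.
have -> : x = 1%N by lia.
rewrite [RHS]ent_subm //= addn0 -schur_tail_row; last by lia.
rewrite /step_X; have [k0|neq_k0] := eqVneq k.+1 1%N.
  by rewrite ent_subm //= (_ : k = 0)%N ?schur_tail0 //; lia.
case: actY => [k0|actY]; first by rewrite k0 in neq_k0.
rewrite ent_subm // actY //; try lia.
by congr schur_tail; lia.
Qed.

Lemma step_fE k Y : (k < N - r)%N -> active_window k Y ->
  step_f A k.+1 Y = subm L k.+2 k.+1 r 1.
Proof.
move=> lt_k actY; rewrite /step_f step_gammaE //.
have U_neq0 : ent U k.+1 k.+1 != 0 by apply: ent_U_diag; lia.
apply: ent_eqP => x y lex ley; have -> : y = 1%N by lia.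
rewrite [RHS]ent_subm //= addn0 ent_scale; apply: (mulfI U_neq0).
rewrite mulVKf // [RHS]mulrC -schur_tail_col; last by lia.
have [k0|neq_k0] := eqVneq k.+1 1%N.
  by rewrite ent_subm //= (_ : k = 0)%N ?schur_tail0 //; lia.
case: actY => [k0|actY]; first by rewrite k0 in neq_k0.
rewrite ent_subm //= !add1n prednK ?ent_col_mx; try lia.
case: leqP => le_x.
  rewrite ent_subm //= ?actY; try lia.
  by congr schur_tail; lia.
rewrite ent_subm ?schur_tail_far; try lia.
by congr ent; lia.
Qed.

Lemma step_ZE k Y u v : (k < N - r)%N -> active_window k Y ->
  (1 <= u <= r)%N -> (1 <= v <= r + 1)%N ->
  ent (step_Z A k.+1 Y) u v = schur_tail k (k.+1 + u) (k.+1 + v).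
Proof.
move=> lt_k actY leu lev; rewrite /step_Z.
have [k0|neq_k0] := eqVneq k.+1 1%N.
  rewrite ent_subm //= (_ : k = 0)%N ?schur_tail0; try lia.
  by congr ent; lia.
case: actY => [k0|actY]; first by rewrite k0 in neq_k0.
rewrite ent_subm //= !add1n !prednK ?ent_col_mx; try lia.
case: leqP => le_u.
  rewrite ent_row_mx; try lia.
  case: leqP => le_v.
    rewrite ent_subm ?actY; try lia.
    by congr schur_tail; lia.
  rewrite ent_subm ?schur_tail_far; try lia.
  by congr ent; lia.
rewrite ent_subm ?schur_tail_far; try lia.
by congr ent; lia.
Qed.

Lemma active_window_step k Y : (k < N - r)%N -> active_window k Y ->
  active_window k.+1
    (- step_f A k.+1 Y *m row_mx (step_X A k.+1 Y) 0 + step_Z A k.+1 Y).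
Proof.
move=> lt_k actY; right=> u v leu lev.
rewrite ent_add ent_mul big_nat1 ent_opp step_fE // step_ZE // mulNr.
(* The band of [U] ends where the zero column is appended to its row. *)
have -> : ent (row_mx (step_X A k.+1 Y) 0 : 'M_(1, r + 1)) 1 v =
          ent U k.+1 (k.+1 + v).
  rewrite step_XE // ent_row_mx; try lia.
  case: leqP => le_v; last by rewrite ent0 ent_U_far //; lia.
  by rewrite ent_subm //; [congr ent|]; lia.
rewrite schur_tailS; last by lia.
rewrite ent_subm //; have -> : (k.+2 + u.-1 = k.+1 + u)%N by lia.
by rewrite addn0 addKr.
Qed.

Lemma schurP k : (k <= N - r)%N -> active_window k (schur A r k).
Proof.
elim: k => [|k IHk] lek; first by left.
by apply: active_window_step; last exact: IHk (ltnW lek).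
Qed.

Lemma schurS k : schur A r k.+1 =
  - step_f A k.+1 (schur A r k) *m row_mx (step_X A k.+1 (schur A r k)) 0
    + step_Z A k.+1 (schur A r k).
Proof. by []. Qed.

Lemma gammaE k : (1 <= k <= N - r)%N -> gamma A r k = ent U k k.
Proof.
by case: k => // k lek; apply: step_gammaE => //; apply: schurP; lia.
Qed.

Lemma XrowE k : (1 <= k <= N - r)%N -> Xrow A r k = subm U k k.+1 1 r.
Proof. by case: k => // k lek; apply: step_XE => //; apply: schurP; lia. Qed.

Lemma fcolE k : (1 <= k <= N - r)%N -> fcol A r k = subm L k.+1 k r 1.
Proof. by case: k => // k lek; apply: step_fE => //; apply: schurP; lia. Qed.

(** The last matrix [Ylast] is the same elimination step with the final
    column, which would fall outside of [A], removed. *)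
Lemma YlastE : Ylast A r =
  subm L (N - r).+1 (N - r).+1 r r *m subm U (N - r).+1 (N - r).+1 r r.
Proof.
have defY : Ylast A r = subm (schur A r (N - r)) 1 1 r r.
  have [k defk] : exists k, (N - r = k.+2)%N by exists (N - r).-2; lia.
  rewrite /Ylast /fcol /Xrow /Zlast defk -[k.+2.-1]/(k.+1).
  rewrite [schur A r k.+2]schurS.
  move: (schur A r k.+1) => Y; apply: ent_eqP => u v leu lev.
  rewrite ent_subm //= !add1n !prednK; try lia.
  rewrite !ent_add !ent_mul !big_nat1; congr (_ + _).
    by rewrite ent_row_mx; try lia; rewrite ifT //; lia.
  rewrite /step_Z /= !ent_subm; try lia.
  rewrite /= !add1n !prednK ?ent_col_mx; try lia.
  case: leqP => le_u.
    by rewrite ent_row_mx; try lia; rewrite ifT //; lia.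
  rewrite !ent_subm; try lia.
  by congr ent; lia.
have actY : active_window (N - r) (schur A r (N - r)) by apply: schurP.
case: actY => [|actY]; first by lia.
rewrite defY; apply: ent_eqP => u v leu lev.
rewrite ent_subm // actY; try lia.
rewrite ent_mul [RHS]big_add1 /schur_tail /= -{1}[(N - r).+1]add0n big_addn.
have -> : (N.+1 - (N - r).+1 = r)%N by lia.
rewrite !big_mkord; apply: eq_bigr => l _; have ltl := ltn_ord l.
rewrite !ent_subm; try lia.
by congr (ent L _ _ * ent U _ _); lia.
Qed.

(** * The product of the elementary factors *)

Let b := (N - r).+1.
Let L22 := subm L b b r r.
Let U22 := subm U b b r r.

Lemma LU_trailing : LU_factorization (Ylast A r) L22 U22.
Proof.
split; last exact: YlastE.
  split; first apply/is_trig_mxP.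
    by move=> i j lt_ij; rewrite mxE ent_L_above //; lia.
  by move=> i; have lti := ltn_ord i; rewrite mxE ent_L_diag //; lia.
apply/is_trig_mxP => i j lt_ij.
by rewrite !mxE ent_U_below //; lia.
Qed.

Lemma U22_unitmx : U22 \in unitmx.
Proof.
case: LU_trailing => _ uS _; rewrite -unitmx_tr unitmx_trig //.
apply/forallP => i; have lti := ltn_ord i.
by rewrite !mxE ent_U_diag //; lia.
Qed.

Lemma L_unitmx : L \in unitmx.
Proof. by case: LU_A => ulL _ _; apply: unit_lower_unitmx. Qed.

Lemma A_unitmx : A \in unitmx.
Proof. by case: LU_A => _ _ ->; rewrite unitmx_mul L_unitmx. Qed.

Lemma invA : invmx A = invmx U *m invmx L.
Proof.
apply: (can_inj (mulKmx A_unitmx)); rewrite mulmxV ?A_unitmx //.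
case: LU_A => _ _ {1}->; rewrite mulmxA mulmxK //.
by rewrite mulmxV // L_unitmx.
Qed.

Lemma Lfac_trig k : is_trig_mx (Lfac A r k).
Proof. by rewrite is_trig_block_mx // eqxx !scalar_mx_is_trig. Qed.

Lemma ent_Lfac k x y : (1 <= k <= N - r)%N ->
  (1 <= x <= 1 + r)%N -> (1 <= y <= 1 + r)%N ->
  ent (Lfac A r k) x y =
    (x == y)%:R - (if (y == 1)%N && (1 < x)%N then ent L (k + x.-1) k else 0).
Proof.
move=> lek lex ley; rewrite ent_col_mx; try lia.
case: leqP => le_x; rewrite ent_row_mx; try lia.
  have -> : x = 1%N by lia.
  rewrite andbF subr0; case: leqP => le_y; last first.
    by rewrite ent0; case: eqP => //; lia.
  by rewrite ent_id //; lia.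
case: leqP => le_y.
  have -> : y = 1%N by lia.
  rewrite ent_opp fcolE // ent_subm; try lia.
  rewrite (_ : x == 1%N = false) ?sub0r ?addn0 /=; last by lia.
  by congr (- ent L _ _); lia.
rewrite ent_id; try lia.
rewrite (_ : y == 1%N = false) ?subr0; last by lia.
by congr (nat_of_bool _)%:R; lia.
Qed.

Lemma ent_Ltilde k i j : (1 <= k <= N - r)%N ->
  (1 <= i <= N)%N -> (1 <= j <= N)%N ->
  ent (Ltilde A r k) i j =
    (i == j)%:R - (if (j == k) && (k < i)%N then ent L i k else 0).
Proof.
move=> lek lei lej; rewrite ent_subm //.
have [-> ->] : (1 + i.-1 = i)%N /\ (1 + j.-1 = j)%N by lia.
rewrite ent_dsum; try lia.
case: (leqP i (k.-1 + (1 + r))) => le_i; last first.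
  rewrite (_ : (if (j == k) && _ then _ else 0) = 0) ?subr0; last first.
    by case: ifP => // _; rewrite ent_L_far //; lia.
  case: (leqP j (k.-1 + (1 + r))) => le_j; first by case: eqP => //; lia.
  rewrite ent_id; try lia.
  by congr (nat_of_bool _)%:R; lia.
case: (leqP j (k.-1 + (1 + r))) => le_j; last first.
  rewrite (_ : j == k = false) ?subr0; last by lia.
  by case: eqP => //; lia.
rewrite ent_dsum; try lia.
case: (leqP i k.-1) => le_ik.
  rewrite (_ : (k < i)%N = false) ?andbF ?subr0; last by lia.
  case: (leqP j k.-1) => le_jk; last by case: eqP => //; lia.
  by rewrite ent_id //; lia.
case: (leqP j k.-1) => le_jk.
  rewrite (_ : j == k = false) ?subr0; last by lia.
  by case: eqP => //; lia.
rewrite ent_Lfac; try lia.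
have -> : (i - k.-1 == j - k.-1)%N = (i == j) by lia.
have -> : (j - k.-1 == 1)%N = (j == k) by lia.
have -> : (1 < i - k.-1)%N = (k < i)%N by lia.
by have -> : (k + (i - k.-1).-1 = i)%N by lia.
Qed.

Definition L_elim k : 'M[F]_N :=
  \matrix_(u, v) if (v < k)%N then (u == v)%:R else L u v.

Lemma ent_L_elim k i j : (1 <= i <= N)%N -> (1 <= j <= N)%N ->
  ent (L_elim k) i j = if (j <= k)%N then (i == j)%:R else ent L i j.
Proof.
case: i j => [//|i] [//|j] lti ltj.
by rewrite !(entE _ (Ordinal lti) (Ordinal ltj)) mxE.
Qed.

(** Column [k.+1] of [L] vanishes outside of the rows [k.+1] to [k.+1 + r], so
    [Ltilde A r k.+1], which modifies these rows only, clears it; the other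
    columns do not change because row [k.+1] of [L_elim k] is that of the
    identity. *)
Lemma Ltilde_elim k : (k < N - r)%N ->
  Ltilde A r k.+1 *m L_elim k = L_elim k.+1.
Proof.
move=> ltk; apply: ent_eqP => i j lei lej.
pose c := if (k.+1 < i)%N then ent L i k.+1 else 0.
have -> : ent (Ltilde A r k.+1 *m L_elim k) i j =
   ent (L_elim k) i j - c * ent (L_elim k) k.+1 j.
  transitivity (\sum_(1 <= l < N.+1) ((if l == i then ent (L_elim k) l j else 0)
    - (if l == k.+1 then c * ent (L_elim k) l j else 0))).
    rewrite ent_mul; apply: eq_big_nat => l lel.
    rewrite ent_Ltilde //; try lia.
    rewrite mulrBl [l == i]eq_sym; congr (_ - _).
      by case: eqP; rewrite ?mul1r ?mul0r.
    by case: eqP => _; rewrite ?mul0r.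
  rewrite sumrB -!big_mkcond /= !big_nat1_eq !ifT //; lia.
rewrite !ent_L_elim; try lia.
have [le_jk|lt_kj] := leqP j k.
  rewrite (_ : k.+1 == j = false) ?mulr0 ?subr0 ?leqW //; lia.
have [->|neq_j] := eqVneq j k.+1.
  rewrite leqnn ent_L_diag ?mulr1 /c; last by lia.
  have [lt_ki|le_ik] := ltnP k.+1 i.
    by rewrite subrr; case: eqP => //; lia.
  rewrite subr0; have [->|neq_i] := eqVneq i k.+1.
    by rewrite ent_L_diag //; lia.
  by rewrite ent_L_above //; lia.
rewrite (_ : (j <= k.+1)%N = false); last by lia.
by rewrite (@ent_L_above k.+1) ?mulr0 ?subr0 //; lia.
Qed.

Lemma descprod_nil n (a : nat -> 'M[F]_n) i j : (i < j)%N ->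
  descprod a i j = 1%:M.
Proof.
rewrite /descprod /index_iota -subn_eq0 => /eqP ->.
by rewrite big_nil.
Qed.

Lemma descprodS n (a : nat -> 'M[F]_n) i j : (j <= i.+1)%N ->
  descprod a i.+1 j = a i.+1 *m descprod a i j.
Proof.
move=> le_ji; rewrite /descprod /index_iota subSn // -addn1 iotaD subnKC //.
by rewrite rev_cat /= big_cons.
Qed.

Lemma Ltilde_prod_elim k : (k <= N - r)%N ->
  descprod (Ltilde A r) k 1 *m L = L_elim k.
Proof.
elim: k => [|k IHk] lek.
  by rewrite descprod_nil // mul1mx; apply/matrixP => u v; rewrite mxE.
by rewrite descprodS // -mulmxA IHk ?Ltilde_elim // ltnW.
Qed.

Lemma subm_mul_full n m (M P : 'M[F]_n) : n = m ->
  subm (M *m P) 1 1 m m = subm M 1 1 m m *m subm P 1 1 m m.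
Proof. by move=> <-; rewrite !subm_full. Qed.

Lemma invL : invmx L = Linv_product A L22.
Proof.
suffices invLT : Linv_product A L22 *m L = 1%:M.
  by apply: (can_inj (mulmxK L_unitmx)); rewrite mulVmx ?L_unitmx.
have unitL22 : L22 \in unitmx.
  by case: LU_trailing => ulT _ _; apply: unit_lower_unitmx.
have -> : Linv_product A L22 *m L = Ltilde_last N L22 *m L_elim (N - r).
  by rewrite -mulmxA Ltilde_prod_elim.
have -> : L_elim (N - r) = subm (dsum (1%:M : 'M_(N - r)) L22) 1 1 N N.
  apply: ent_eqP => i j lei lej; rewrite ent_L_elim // ent_subm //.
  have [-> ->] : (1 + i.-1 = i)%N /\ (1 + j.-1 = j)%N by lia.
  rewrite ent_dsum; try lia.
  case: (leqP j (N - r)) => le_j; case: (leqP i (N - r)) => le_i.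
  - by rewrite ent_id //; lia.
  - by case: eqP => //; lia.
  - by rewrite ent_L_above //; lia.
  by rewrite ent_subm; [congr ent|..]; lia.
rewrite -subm_mul_full; last by lia.
rewrite mulmx_block !mulmx0 !mul0mx !addr0 !add0r mulmx1 mulVmx //.
rewrite -[block_mx _ _ _ _]/(dsum 1%:M 1%:M) /dsum -scalar_mx_block.
have eN : (N - r + r = N)%N by lia.
apply: ent_eqP => i j lei lej; rewrite ent_subm // !ent_id ?addn1; try lia.
by congr (nat_of_bool _)%:R; lia.
Qed.

(** * Green generators of the inverse *)

Let B : 'M[F]_N := invmx A.

Lemma mul_B_L : B *m L = invmx U.
Proof. by rewrite /B invA mulmxKV // L_unitmx. Qed.

Lemma mul_U_B : U *m B = invmx L.
Proof. by rewrite /B invA mulKVmx. Qed.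

(** [B *m L = invmx U] is upper triangular, and column [k] of the banded [L]
    has the entry 1 followed by [fcol A r k]: below the diagonal, column [k] of
    the inverse is a combination of the next [r] columns. *)
Lemma inv_col k i s : (1 <= k <= N - r)%N -> (k < i)%N ->
  subm B i k s 1 = - (subm B i k.+1 s r *m fcol A r k).
Proof.
move=> lek lt_ki; apply/eqP; rewrite -subr_eq0 opprK; apply/eqP.
have uUV : is_trig_mx (invmx U)^T.
  by apply: upper_inv => //; case: LU_A.
have -> : 0 = subm (B *m L) i k s 1.
  apply/matrixP => x y; have lty := ltn_ord y.
  by rewrite !mxE mul_B_L -ent_tr (ent_trig uUV) //; lia.
rewrite (subm_mul_window (c := k) (w := 1 + r)); try lia; last first.
  move=> x l y lex lel ley out_l; have -> : y = k by lia.
  have [lt_lk|le_kl] := ltnP l k; first by rewrite ent_L_above ?mulr0 //; lia.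
  by rewrite ent_L_far ?mulr0 //; lia.
rewrite subm_row_mx subm_col_mx mul_row_col !addn1 fcolE //.
rewrite (_ : subm L k k 1 1 = 1%:M) ?mulmx1 //.
by apply/matrixP => x y; rewrite !ord1 !mxE !addn0 ent_L_diag //; lia.
Qed.

(** The lower part [[- fcol k, 1]] of [L_k] thus recovers column [k] from the
    next [r] columns and leaves these unchanged. *)
Lemma inv_window k i s : (1 <= k <= N - r)%N -> (k < i)%N ->
  subm B i k.+1 s r *m dsubmx (Lfac A r k) = subm B i k s (1 + r).
Proof.
move=> lek lt_ki; rewrite col_mxKd mul_mx_row mulmxN mulmx1 -inv_col //.
by rewrite subm_row_mx addn1.
Qed.

Lemma subm_dsubmx (M : 'M[F]_(1 + r)) c t : (0 < c)%N ->
  subm M 2 c r t = subm (dsubmx M) 1 c r t.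
Proof.
move=> c_gt0; apply: ent_eqP => x y lex ley.
rewrite !ent_subm // -{1}[M]vsubmxK.
rewrite ent_col_mx; try lia.
have -> : (2 + x.-1 <= 1)%N = false by lia.
by congr ent; lia.
Qed.

Lemma green_shift_a k i s : (1 <= k <= N - r)%N -> (k < i)%N ->
  subm B i k.+1 s r *m green_a A r k = subm B i k s r.
Proof.
move=> lek lt_ki; rewrite /green_a /aL subm_dsubmx //.
rewrite mul_subm_cols inv_window //.
rewrite subm_subm /= ?addn0 //; lia.
Qed.

Lemma green_shift_q k i s : (1 <= k <= N - r)%N -> (k < i)%N ->
  subm B i k.+1 s r *m green_q A r k = subm B i (r + k) s 1.
Proof.
move=> lek lt_ki; rewrite /green_q /qL subm_dsubmx //.
rewrite mul_subm_cols inv_window //.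
rewrite [(r + k)%N]addnC subm_subm /= ?addn0 //; lia.
Qed.

Lemma green_shift_prod m j i s : (0 < j <= m.+1)%N -> (m <= N - r)%N ->
  (m < i)%N ->
  subm B i m.+1 s r *m descprod (green_a A r) m j = subm B i j s r.
Proof.
elim: m => [|m IHm] lej lem lt_mi.
  have -> : j = 1%N by lia.
  by rewrite descprod_nil // mulmx1.
have [->|neq_j] := eqVneq j m.+2; first by rewrite descprod_nil ?mulmx1.
rewrite descprodS ?mulmxA ?green_shift_a ?IHm //; lia.
Qed.

(** Row [k] of [U *m B = invmx L]: both [U] and [invmx L] have a known row
    there, which leaves row [k] of [B] in terms of the [r] rows below. *)
Lemma step_p_inv k : (1 <= k <= N - r)%N ->
  step_p A k (subm B k.+1 k.+1 r r) = subm B k k 1 r.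
Proof.
move=> lek; have U_neq0 : ent U k k != 0 by apply: ent_U_diag; lia.
rewrite /step_p gammaE // -mulmxA green_shift_a // XrowE //.
apply: (scalerI U_neq0); rewrite scalerA mulfV // scale1r.
apply/eqP; rewrite subr_eq; apply/eqP.
have ulLV : unit_lower_triangular (invmx L).
  by apply: unit_lower_inv; case: LU_A.
have -> : pL A r k = subm (U *m B) k k 1 r.
  rewrite mul_U_B; apply/matrixP => x y; rewrite !mxE ord1 /= !addn0.
  have lty := ltn_ord y; rewrite ent_Lfac ?andbF ?subr0; try lia.
  have [-> | neq_y0] := eqVneq (y : nat) 0%N.
    by rewrite !addn0 ent_unit_lower //; lia.
  rewrite (ent_trig ulLV.1); try lia.
  by case: eqP => //; lia.
rewrite (subm_mul_window (c := k) (w := 1 + r)); try lia; last first.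
  move=> x l y lex lel ley out_l; have -> : x = k by lia.
  have [lt_lk|le_kl] := ltnP l k; first by rewrite ent_U_below ?mul0r //; lia.
  by rewrite ent_U_far ?mul0r //; lia.
rewrite subm_row_mx subm_col_mx mul_row_col !addn1; congr (_ + _).
rewrite -mul_scalar_mx; congr (_ *m _).
by apply/matrixP => x y; rewrite !ord1 !mxE !addn0.
Qed.

(** The last [r] rows of [U] and the last [r] columns of [L] vanish outside of
    the trailing block, so [U *m B *m L = 1] restricts to the trailing blocks of
    the three matrices. *)
Lemma inv_trailing : green_p_last L22 U22 = subm B b b r r.
Proof.
case: LU_trailing => ulT _ _; have unitT := unit_lower_unitmx ulT.
have SBT : U22 *m subm B b b r r *m L22 = 1%:M.
  have -> : U22 *m subm B b b r r = subm (U *m B) b b r r.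
    rewrite (subm_mul_window (c := b) (w := r)) //; try lia.
    move=> x l y lex lel ley out_l.
    by rewrite ent_U_below ?mul0r //; lia.
  rewrite -(subm_mul_window (c := b) (w := r)) //; try lia; last first.
    move=> x l y lex lel ley out_l.
    by rewrite (@ent_L_above l) ?mulr0 //; lia.
  rewrite mul_U_B mulVmx ?L_unitmx //; apply: ent_eqP => i j lei lej.
  rewrite ent_subm // !ent_id; try lia.
  by congr (nat_of_bool _)%:R; lia.
rewrite /green_p_last /Lfac_last; apply: (can_inj (mulKmx U22_unitmx)).
rewrite mulKVmx ?U22_unitmx //; apply: (can_inj (mulmxK unitT)).
by rewrite mulVmx // SBT.
Qed.

(** The first row of the diagonal block is [p(k)], and its other rows are those
    of the next block, except its last row, shifted by one column. *)
Lemma green_t_down_inv d : (d <= N - r)%N ->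
  green_t_down A L22 U22 d = subm B (b - d) (b - d) r r.
Proof.
elim: d => [|d IHd] led; first by rewrite subn0 -inv_trailing.
rewrite /= IHd; last by lia.
set k := (N - r - d)%N.
have [-> ->] : (b - d = k.+1)%N /\ (b - d.+1 = k)%N by lia.
rewrite step_p_inv; last by lia.
rewrite subm_subm; try lia.
rewrite /= !addn0 green_shift_a; try lia.
rewrite -[k.+1]addn1 -subm_col_mx subm_subm; try lia.
by rewrite /= !addn0.
Qed.

Lemma green_p_inv k : (1 <= k <= N - r)%N ->
  green_p A L22 U22 k = subm B k k 1 r.
Proof.
move=> lek; rewrite /green_p /green_t green_t_down_inv; last by lia.
have -> : (b - ((N - r).+1 - k.+1) = k.+1)%N by lia.
exact: step_p_inv.
Qed.

Lemma green_generators_inv :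
  lower_Green_generators B (green_p A L22 U22) (green_q A r) (green_a A r)
    (green_p_last L22 U22).
Proof.
split.
- case=> // i lei; rewrite green_p_inv // green_shift_prod //; lia.
- move=> [//|i] j j_gt0 lt_ji lei.
  rewrite green_p_inv ?green_shift_prod ?green_shift_q //; lia.
- by rewrite inv_trailing green_shift_prod //; lia.
move=> j lej; rewrite inv_trailing green_shift_prod ?green_shift_q //; lia.
Qed.

End Factors.

(** * The factorization and the generators *)

Theorem theorem5p8 (R : realType) (N r : nat) (r_gt0 : (0 < r)%N)
    (leN : (r + 2 <= N)%N) (A : 'M[R[i]]_N)
    (Areg : strongly_regular A) (Aband : two_sided_band r A) :
  [/\ forall k, (1 <= k <= N - r)%N -> gamma A r k != 0,
      exists T S : 'M[R[i]]_r, LU_factorization (Ylast A r) T S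
    & forall T S : 'M[R[i]]_r, LU_factorization (Ylast A r) T S ->
      [/\ S \in unitmx,
          forall k, (1 <= k <= N - r)%N -> is_trig_mx (Lfac A r k),
          is_trig_mx (Lfac_last T)
        & exists L Rf : 'M[R[i]]_N,
          [/\ A = L *m Rf,
              [/\ L \in unitmx, is_trig_mx L & invmx L = Linv_product A T],
              upper_triangular Rf /\ upper_band r Rf,
              [/\ forall k, (1 <= k <= N - r)%N -> ent Rf k k = gamma A r k,
                  forall k, (1 <= k <= N - r)%N ->
                    subm Rf k k.+1 1 r = Xrow A r k
                & subm Rf (N - r).+1 (N - r).+1 r r = S]
            & [/\ A \in unitmx, Rf \in unitmx,
                  invmx A = invmx Rf *m invmx L
                & lower_Green_generators (invmx A)
                    (green_p A T S) (green_q A r) (green_a A r)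
                    (green_p_last T S)]]]].
Proof.
have [L [U LU_A]] := strongly_regular_LU Areg.
have unitU : U \in unitmx.
  have := strongly_regular_unitmx Areg; case: LU_A => _ _ ->.
  by rewrite unitmx_mul => /andP[].
have LU_Y := LU_trailing r_gt0 leN Aband LU_A unitU.
have unitS := U22_unitmx r_gt0 leN Aband LU_A unitU.
split.
- move=> k lek; rewrite (gammaE _ _ Aband LU_A) //.
  by apply: (ent_U_diag LU_A unitU); lia.
- by do 2!eexists; exact: LU_Y.
move=> T S /(LU_unique unitS)/(_ LU_Y)[-> ->].
case: (LU_A) => ulL uU defA; case: (LU_Y) => ulT _ _.
split=> //.
- by move=> k _; apply: Lfac_trig.
- by case: (unit_lower_inv ulT).
exists L, U; split=> //.
- split; [exact: unit_lower_unitmx|by case: ulL|].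
  exact: (invL r_gt0 leN Aband LU_A unitU).
- by split=> //; apply: LU_upper_band LU_A Aband.
- split=> // k lek; first by rewrite (gammaE _ _ Aband LU_A).
  by rewrite (XrowE _ _ Aband LU_A).
split=> //.
- exact: strongly_regular_unitmx.
- exact: invA LU_A unitU.
exact: green_generators_inv.
Qed.
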